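(* (ZFC) Let $X \subseteq {}^\omega 2$ with $|X| = \mathfrak{c}$. Then $X$ is not $s_0$-shiftable, i.e., there is a $Y \in s_0$ such that $X + Y = {}^\omega 2$.
   Context: ${}^\omega 2$ is the Cantor space, regarded as a group under bitwise addition modulo $2$, denoted $+$; $\mathfrak{c} = 2^{\aleph_0}$. For $X,Y\subseteq {}^\omega 2$ and $t\in{}^\omega 2$, $X+Y=\{x+y: x\in X, y\in Y\}$ and $X+t=\{x+t:x\in X\}$. A set $Y \subseteq {}^\omega 2$ is Marczewski null ($Y \in s_0$) if for every perfect set $P \subseteq {}^\omega 2$ there is a perfect set $Q \subseteq P$ with $Q \cap Y = \emptyset$. For a collection $\mathcal I\subseteq\mathcal P({}^\omega 2)$, a set $X \subseteq {}^\omega 2$ is $\mathcal I$-shiftable if $X + Y \neq {}^\omega 2$ for every $Y \in \mathcal I$. *)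

(* Defs.v *)
From Stdlib Require Import Bool.

Definition cantor := nat -> bool.

Definition cadd (x y : cantor) : cantor := fun n => xorb (x n) (y n).

Definition agree (n : nat) (x y : cantor) : Prop := forall k, k < n -> x k = y k.

Definition closed_set (P : cantor -> Prop) : Prop :=
  forall x, ~ P x -> exists n, forall y, agree n x y -> ~ P y.

Definition perfect (P : cantor -> Prop) : Prop :=
  (exists x, P x) /\ closed_set P /\
  (forall x, P x -> forall n, exists y, P y /\ y <> x /\ agree n x y).

Definition s0 (Y : cantor -> Prop) : Prop :=
  forall P, perfect P ->
    exists Q, perfect Q /\ (forall z, Q z -> P z) /\ (forall z, Q z -> ~ Y z).

Definition sumset (X Y : cantor -> Prop) : cantor -> Prop :=
  fun z => exists x y, X x /\ Y y /\ z = cadd x y.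

Definition shiftable (I : (cantor -> Prop) -> Prop) (X : cantor -> Prop) : Prop :=
  forall Y, I Y -> exists z, ~ sumset X Y z.

Definition card_continuum (X : cantor -> Prop) : Prop :=
  exists f : {x : cantor | X x} -> cantor,
    (forall a b, f a = f b -> a = b) /\ (forall z, exists a, f a = z).

(* Main.v *)
(* Call a set small if it does not map onto the Cantor space.  By a well-ordering of the
   Cantor space with small initial segments it suffices to find, for each a, some x in X
   such that a + x avoids the a-many earlier sets of a family D dense among the perfect
   sets: the points a + x form a set meeting each member of D in a small set.

   A perfect set is skew if at most one node splits at each level of its tree; distinct
   translates of a skew set have no perfect set in common.  Take a maximal family M of skew
   sets R such that translates of different members have no perfect set in common.  The
   sets contained in some R + t, R in M, are dense, and if D fails to work for them then a
   small family of translates R_i + w_i covers X.  Sending x in R_i + w_i to x + w_i in R_i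
   splits X according to R_i; if some image is not small, shrink X so that this image
   becomes Marczewski null and the others empty, otherwise all the images are small, hence
   Marczewski null.  In both cases the subsets Q of R + t such that Q + t misses the image
   of X in R are still dense, and a translate of such a Q meets each R_i + w_i in only
   countably many points of X.  Hence fewer than continuum many such translates do not cover
   X.  Working with a family that is almost disjoint up to translation makes the argument
   insensitive to the cofinality of the continuum. *)
From Corelib Require Import ssreflect ssrbool.
From Stdlib Require Import Bool Arith Lia Wellfounded Cantor.
From Stdlib Require Import Classical ClassicalEpsilon FunctionalExtensionality.
From Stdlib Require Import PropExtensionality.
From mathcomp Require eqtype boolp wochoice.
Require Import Defs.

(** * Cardinal arithmetic below the continuum *)

(** Expresses |T| <= |S| for nonempty [T]. Since [g] may send points of [S] outside [T], shrinking
    [T] costs nothing. *)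
Definition covers {A B} (S : A -> Prop) (T : B -> Prop) :=
  exists g : A -> B, forall b, T b -> exists a, S a /\ g a = b.

Definition univ {A} (x : A) := True.

Definition small {A} (S : A -> Prop) := ~ covers S (@univ cantor).

Definition countable {A} (S : A -> Prop) := covers (@univ nat) S.

Definition setX {A B} (S : A -> Prop) (T : B -> Prop) (p : A * B) :=
  S (fst p) /\ T (snd p).

Lemma covers_functional {A B} (S : A -> Prop) (T : B -> Prop) (r : A -> B -> Prop) :
  inhabited B ->
  (forall b, T b -> exists a, S a /\ r a b) ->
  (forall a b b', S a -> T b -> T b' -> r a b -> r a b' -> b = b') ->
  covers S T.
Proof.
move=> iB H U; exists (fun a => epsilon iB (fun b => T b /\ r a b)) => b Tb.
have [a [Sa rab]] := H b Tb; exists a; split=> //.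
have [Tb' rab'] := epsilon_spec iB (fun b => T b /\ r a b) (ex_intro _ b (conj Tb rab)).
exact: (U a).
Qed.

Lemma covers_image {A B} (S : A -> Prop) (T : B -> Prop) (g : A -> B) :
  (forall b, T b -> exists a, S a /\ g a = b) -> covers S T.
Proof. by exists g. Qed.

Lemma covers_sub {A} (S T : A -> Prop) : (forall x, T x -> S x) -> covers S T.
Proof. by move=> H; exists (fun x => x) => b /H; exists b. Qed.

Lemma covers_trans {A B C} (S : A -> Prop) (T : B -> Prop) (U : C -> Prop) :
  covers S T -> covers T U -> covers S U.
Proof.
move=> [g Hg] [h Hh]; exists (fun a => h (g a)) => c /Hh[b [/Hg[a [Sa <-]] <-]].
by exists a.
Qed.

Lemma covers_setX {A B C D} (S : A -> Prop) (T : B -> Prop) (U : C -> Prop) (V : D -> Prop) :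
  covers S U -> covers T V -> covers (setX S T) (setX U V).
Proof.
move=> [g Hg] [h Hh]; exists (fun p => (g (fst p), h (snd p))) => -[c d] [/= Uc Vd].
have [a [Sa <-]] := Hg c Uc; have [b [Tb <-]] := Hh d Vd.
by exists (a, b).
Qed.

Lemma covers_point {A B} (S : A -> Prop) (b : B) :
  (exists a, S a) -> covers S (fun x => x = b).
Proof. by move=> [a Sa]; exists (fun _ => b) => _ ->; exists a. Qed.

Lemma covers_nat_nat : covers (@univ nat) (setX (@univ nat) (@univ nat)).
Proof. by exists Cantor.of_nat => p _; exists (Cantor.to_nat p); rewrite Cantor.cancel_of_to. Qed.

Lemma covers_setX_nat {A} (S : A -> Prop) : covers (setX S (@univ nat)) S.
Proof. by exists fst => a Sa; exists (a, 0). Qed.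

Lemma covers_setXA {A B C} (S : A -> Prop) (T : B -> Prop) (U : C -> Prop) :
  covers (setX S (setX T U)) (setX (setX S T) U).
Proof.
exists (fun p => ((fst p, fst (snd p)), snd (snd p))) => -[[a b] c] [/= [/= Sa Tb] Uc].
by exists (a, (b, c)).
Qed.

Lemma small_covers {A B} (S : A -> Prop) (T : B -> Prop) :
  covers S T -> small S -> small T.
Proof. by move=> ST sS TC; apply: sS (covers_trans _ _ _ ST TC). Qed.

Definition interleave (u v : cantor) : cantor :=
  fun n => if Nat.even n then u (Nat.div2 n) else v (Nat.div2 n).
Definition evens (x : cantor) : cantor := fun n => x (2 * n).
Definition odds (x : cantor) : cantor := fun n => x (S (2 * n)).

Lemma evens_interleave u v : evens (interleave u v) = u.
Proof.
apply: functional_extensionality => n; rewrite /evens /interleave.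
by rewrite Nat.even_mul Nat.div2_double.
Qed.

Lemma odds_interleave u v : odds (interleave u v) = v.
Proof.
apply: functional_extensionality => n; rewrite /odds /interleave.
by rewrite Nat.even_succ Nat.odd_mul Nat.div2_succ_double.
Qed.

(* Koenig's argument: a surjection from S u T onto the square of the continuum
   either projects onto it from S, or is onto a whole column on T. *)
Lemma small_union {A} (S T : A -> Prop) :
  small S -> small T -> small (fun x => S x \/ T x).
Proof.
move=> sS sT [f Hf]; apply: sT.
have [a Ha] : exists a, forall s, S s -> evens (f s) <> a.
  apply: NNPP => H; apply: sS; exists (fun s => evens (f s)) => a _.
  by apply: NNPP => H'; apply: H; exists a => s Ss E; apply: H'; exists s.
exists (fun t => odds (f t)) => b _.
have [x [[Sx|Tx] E]] := Hf (interleave a b) I.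
  by case: (Ha x Sx); rewrite E evens_interleave.
by exists x; rewrite E odds_interleave.
Qed.

(** A diagonal argument, valid whatever the cofinality of the continuum: for each [n] the column [n]
    of [f (s, n)] misses some [a n], and the point [y] with columns [a n] is then not a value of
    [f]. *)
Lemma small_setX_nat {A} (S : A -> Prop) : small S -> small (setX S (@univ nat)).
Proof.
move=> sS [f Hf].
pose col n (x : cantor) : cantor := fun k => x (Cantor.to_nat (n, k)).
have H n : exists a, forall s, S s -> col n (f (s, n)) <> a.
  apply: NNPP => H; apply: sS; exists (fun s => col n (f (s, n))) => a _.
  by apply: NNPP => H'; apply: H; exists a => s Ss E; apply: H'; exists s.
have [a Ha] := choice _ H.
pose y : cantor := fun m => a (fst (Cantor.of_nat m)) (snd (Cantor.of_nat m)).
have [[s n] [[/= Ss _] E]] := Hf y I.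
apply: (Ha n s Ss); apply: functional_extensionality => k.
by rewrite E /col /y Cantor.cancel_of_to.
Qed.

Lemma countable_small {A} (S : A -> Prop) : countable S -> small S.
Proof.
move=> cS; apply: (small_covers (setX (fun u : unit => u = tt) (@univ nat))).
  apply: covers_trans cS; exists snd => n _; by exists (tt, n).
apply: small_setX_nat => -[f Hf].
have [[] [_ E1]] := Hf (fun _ => true) I; have [[] [_ E2]] := Hf (fun _ => false) I.
by have := f_equal (fun g => g 0) E1; rewrite E2.
Qed.

Lemma small_point {A} (a : A) : small (fun x => x = a).
Proof. by apply: countable_small; apply: covers_point; exists 0. Qed.

(** * Well-orders and recursion along them *)

Definition strict_well_order {T} (lt : T -> T -> Prop) :=
  well_founded lt /\ (forall x y z, lt x y -> lt y z -> lt x z) /\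
  (forall x y, lt x y \/ x = y \/ lt y x).

Lemma wf_irrefl {T} (lt : T -> T -> Prop) x : well_founded lt -> ~ lt x x.
Proof. by move=> wf; elim/(well_founded_ind wf): x => x IH H; apply: (IH x H H). Qed.

Lemma wf_min {T} (lt : T -> T -> Prop) (P : T -> Prop) :
  well_founded lt -> (exists x, P x) -> exists x, P x /\ forall y, lt y x -> ~ P y.
Proof.
move=> wf [x Px]; apply: NNPP => H.
elim/(well_founded_ind wf): x Px => x IH Px.
by apply: H; exists x; split=> // y /IH.
Qed.

(** The principle quoted gives every nonempty predicate a unique least element. Sets of one, two and
    three points yield the order axioms, and the set of inaccessible points yields
    well-foundedness. *)
Lemma strict_well_order_exists T : exists lt : T -> T -> Prop, strict_well_order lt.
Proof.
pose T' : eqtype.Equality.type :=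
  boolp.boolp_classicType__canonical__eqtype_Equality T.
have [R woR] := wochoice.well_ordering_principle T'.
pose le x y : Prop := R x y = true.
have minR (P : T -> Prop) : (exists x, P x) ->
    exists x, P x /\ (forall y, P y -> le x y) /\
      forall z, P z -> (forall y, P y -> le z y) -> x = z.
  move=> [x Px].
  have [|z [[/boolp.asboolP Pz lz] uz]] := woR (fun x => boolp.asbool (P x)).
    by exists x; apply/boolp.asboolP.
  exists z; split=> //; split=> [y Py|w Pw lw].
    by apply: lz; apply/boolp.asboolP.
  apply: uz; split; first exact/boolp.asboolP.
  by move=> y /boolp.asboolP; apply: lw.
have refl x : le x x.
  by have [y [-> [H _]]] := minR (fun y => y = x) (ex_intro _ x eq_refl); apply: H.
have tot x y : le x y \/ le y x.
  have [|z [[->|->] [H _]]] := minR (fun z => z = x \/ z = y).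
  - by exists x; left.
  - by left; apply: H; right.
  - by right; apply: H; left.
have anti x y : le x y -> le y x -> x = y.
  move=> xy yx; have [|z [Pz [H U]]] := minR (fun z => z = x \/ z = y).
    by exists x; left.
  have zx : z = x by apply: U; [left | move=> w [->|->]].
  have zy : z = y by apply: U; [right | move=> w [->|->]].
  by rewrite -zx -zy.
have wf : well_founded (fun x y => le x y /\ x <> y).
  move=> x; apply: NNPP => nx.
  have [z [nz [H _]]] := minR (fun z => ~ Acc (fun x y => le x y /\ x <> y) z) (ex_intro _ x nx).
  apply: nz; constructor => y [yz ne]; apply: NNPP => ny.
  by apply: ne; apply: anti => //; apply: H.
exists (fun x y => le x y /\ x <> y); split=> //; split.
- move=> x y z [xy nxy] [yz nyz].
  have xz : le x z.
    have [|w [Pw [H U]]] := minR (fun w => w = x \/ w = y \/ w = z).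
      by exists x; left.
    have Hx := H x (or_introl eq_refl).
    have Hy := H y (or_intror (or_introl eq_refl)).
    have Hz := H z (or_intror (or_intror eq_refl)).
    case: Pw => [E|[E|E]]; subst w => //.
      by case: nxy; apply: anti.
    by case: nyz; apply: anti.
  by split=> // E; subst z; apply: nxy; apply: anti.
- move=> x y; case: (classic (x = y)) => [->|ne]; first by right; left.
  have [xy|yx] := tot x y; first by left.
  by right; right; split=> // E; apply: ne.
Qed.

Lemma wf_recursion {A T} (lt : A -> A -> Prop) (F : forall x, (forall y, lt y x -> T) -> T) :
  well_founded lt -> exists f, forall x, f x = F x (fun y _ => f y).
Proof.
move=> wf; exists (Fix wf (fun _ => T) F) => x; rewrite Fix_eq // => y f g fg.
f_equal; apply: functional_extensionality_dep => z.
exact: functional_extensionality_dep.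
Qed.

Lemma greedy_enumeration {A T} (lt : A -> A -> Prop) (S : T -> Prop) :
  well_founded lt -> inhabited T ->
  exists g : A -> T, forall p, (exists s, S s /\ forall q, lt q p -> g q <> s) ->
    S (g p) /\ forall q, lt q p -> g q <> g p.
Proof.
move=> wf iT.
pose F p (g : forall q, lt q p -> T) :=
  epsilon iT (fun s => S s /\ forall q (qp : lt q p), g q qp <> s).
have [g Hg] := wf_recursion lt F wf.
exists g => p Hp.
have := epsilon_spec iT (fun s => S s /\ forall q, lt q p -> g q <> s) Hp.
by rewrite (Hg p).
Qed.

(** If some initial segment is not small, let [v] be the least point whose segment maps onto the
    Cantor space, by [f]. The order is pulled back along a section [r] of [f] with values below [v],
    and minimality of [v] makes the new segments small. *)
Lemma continuum_order_exists : exists lt : cantor -> cantor -> Prop,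
  strict_well_order lt /\ forall a, small (fun b => lt b a).
Proof.
have [lt wo] := strict_well_order_exists cantor.
have [wf [tr tot]] := wo.
case: (classic (forall a, small (fun b => lt b a))) => [H|]; first by exists lt.
move=> /not_all_ex_not /(wf_min lt _ wf) [v [/NNPP [f Hf] minv]].
have [r Hr] : exists r : cantor -> cantor, forall a, lt (r a) v /\ f (r a) = a.
  exact: choice _ (fun a => Hf a I).
exists (fun a b => lt (r a) (r b)); split; last first.
  move=> b; have [rv _] := Hr b.
  have /NNPP := minv _ rv; apply: small_covers.
  by exists f => a ab; exists (r a); split=> //; apply Hr.
split; first exact: wf_inverse_image.
split=> [x y z|x y]; first exact: tr.
have [H|[H|H]] := tot (r x) (r y); [by left | right; left | by right; right].
by case: (Hr x) => _ <-; case: (Hr y) => _ <-; rewrite H.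
Qed.

Definition clt : cantor -> cantor -> Prop :=
  proj1_sig (constructive_indefinite_description _ continuum_order_exists).

Lemma clt_spec : strict_well_order clt /\ forall a, small (fun b => clt b a).
Proof. exact: (proj2_sig (constructive_indefinite_description _ continuum_order_exists)). Qed.

Lemma clt_wf : well_founded clt.
Proof. exact: (proj1 (proj1 clt_spec)). Qed.

Lemma clt_trans x y z : clt x y -> clt y z -> clt x z.
Proof. exact: (proj1 (proj2 (proj1 clt_spec))). Qed.

Lemma clt_total x y : clt x y \/ x = y \/ clt y x.
Proof. exact: (proj2 (proj2 (proj1 clt_spec))). Qed.

Definition below (a b : cantor) := clt b a.

Lemma small_below a : small (below a).
Proof. exact: (proj2 clt_spec). Qed.

Lemma small_not_above a : small (fun b => ~ clt a b).
Proof.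
apply: small_covers (small_union _ _ (small_below a) (small_point a)).
by apply: covers_sub => b H; have [|[|]] := clt_total a b; auto.
Qed.

(* Hessenberg's argument: well-order pairs by their maximum first and enumerate
   greedily; if the enumeration stops early, then [below v] is covered by the square
   of an initial segment [not above m] with [m] below [v]. *)
Lemma below_square v : covers (setX (below v) (@univ nat)) (setX (below v) (below v)).
Proof.
elim/(well_founded_ind clt_wf): v => v IH.
pose N := @univ nat; have nn := covers_nat_nat.
have sqN u : clt u v ->
    covers (setX (below u) N) (setX (setX (below u) N) (setX (below u) N)).
  move=> uv; pose U := below u.
  have [g Hg] : covers (setX (setX U U) (setX N N)) (setX (setX U N) (setX U N)).
    exists (fun p => ((fst (fst p), fst (snd p)), (snd (fst p), snd (snd p)))).
    by move=> [[a m] [b n]] [[/= ? ?] [/= ? ?]]; exists ((a, b), (m, n)).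
  apply: covers_trans (ex_intro _ g Hg).
  apply: covers_trans (covers_setX _ _ _ _ (IH u uv) nn).
  apply: covers_trans (covers_setXA _ _ _).
  apply: covers_setX; first exact: covers_sub.
  exact: nn.
(* If [below v] is no larger than [below u] times [nat] for an earlier [u], the square of the latter
   is already controlled by [sqN]. *)
case: (classic (exists u, clt u v /\ covers (setX (below u) N) (below v))).
  move=> [u [uv H]].
  apply: covers_trans (covers_setX _ _ _ _ H H).
  apply: covers_trans (sqN u uv).
  apply: covers_setX; apply: covers_sub => // x xu.
  exact: clt_trans uv.
move=> nu.
have [ltp [wfp [_ totp]]] := strict_well_order_exists (cantor * cantor).
pose mx (p : cantor * cantor) :=
  if excluded_middle_informative (clt (fst p) (snd p)) then snd p else fst p.
pose lt p q := clt (mx p) (mx q) \/ mx p = mx q /\ ltp p q.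
have wf : well_founded lt.
  have W := wf_inverse_image _ _ _ (fun p => (mx p, p)) (wf_slexprod _ _ _ _ clt_wf wfp).
  move=> p; elim/(well_founded_ind W): p => p IHp; constructor => q [H|[E H]].
    by apply: IHp; left.
  by apply: IHp; rewrite E; right.
have tot p q : lt p q \/ p = q \/ lt q p.
  have [H|[E|H]] := clt_total (mx p) (mx q); [by left; left | | by right; right; left].
  have [H|[H|H]] := totp p q; [by left; right | by right; left | by right; right; right].
have le_mx p : ~ clt (mx p) (fst p) /\ ~ clt (mx p) (snd p).
  rewrite /mx; case: excluded_middle_informative => [H|H]; split=> //; try exact: wf_irrefl clt_wf.
  by move=> H'; apply: (wf_irrefl _ (fst p) clt_wf); apply: clt_trans H H'.
have [g Hg] := greedy_enumeration lt (below v) wf (inhabits v).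
(* Either every pair finds a fresh value, so [g] is injective on the square, or the predecessors of
   some [p] exhaust [below v]. *)
case: (classic (exists p, (below v (fst p) /\ below v (snd p)) /\
   ~ exists s, below v s /\ forall q, lt q p -> g q <> s)); last first.
  move=> H; apply: covers_trans (covers_setX_nat _) _.
  have Hg' p : setX (below v) (below v) p ->
      below v (g p) /\ forall q, lt q p -> g q <> g p.
    by move=> Vp; apply: Hg; apply: NNPP => ne; apply: H; exists p.
  apply: (covers_functional _ _ (fun a p => g p = a)); first exact: (inhabits (v, v)).
    by move=> p /Hg' [H1 _]; exists (g p).
  move=> a p q _ /Hg' [_ Hp] /Hg' [_ Hq] Ep Eq.
  by have [/Hq|[//|/Hp]] := tot p q; case; rewrite Ep Eq.
move=> [p [[V1 V2] H]].
have mv : clt (mx p) v by rewrite /mx; case: excluded_middle_informative.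
pose m := mx p; pose L b := ~ clt m b.
have HL s : below v s -> exists q, setX L L q /\ g q = s.
  move=> Vs; apply: NNPP => ne; apply: H; exists s; split=> // q qp E.
  apply: ne; exists q; split=> //; have [a b] := le_mx q.
  have qm x : ~ clt (mx q) x -> L x.
    move=> nx mx'; case: qp => [qp|[qp _]]; apply: nx; last by rewrite qp.
    exact: clt_trans qp mx'.
  by split; apply: qm.
(* Covering [L] by [below m] times [nat] needs a point below [m] to carry the extra value [m].
   Without one, [below v] is a single point. *)
case: (classic (exists a, clt a m)) => [[a0 a0m]|em].
  case: nu; exists m; split=> //.
  have LN : covers (setX (below m) (@univ nat)) L.
    exists (fun x => if Nat.eqb (snd x) 0 then m else fst x) => b Lb.
    have [bm|[->|/Lb []]] := clt_total b m; first by exists (b, 1).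
    by exists (a0, 0).
  apply: covers_trans (covers_image _ _ g HL).
  exact: covers_trans (sqN m mv) (covers_setX _ _ _ _ LN LN).
have Lm x : L x -> x = m.
  by move=> Lx; have [xm|[->|/Lx []]] := clt_total x m => //; case: em; exists x.
have Vm x : below v x -> x = g (m, m).
  by move=> /HL [[a b] [[/= /Lm -> /Lm ->] <-]].
apply: covers_trans (covers_sub (fun x => x = (m, m)) _ _).
  by apply: covers_point; exists (m, 0).
by move=> [a b] [/= /Vm -> /Vm ->]; rewrite -(Vm m mv).
Qed.

(** * Perfect and skew sets *)

Lemma agree_sym n x y : agree n x y -> agree n y x.
Proof. by move=> H k /H. Qed.

Lemma agree_trans n x y z : agree n x y -> agree n y z -> agree n x z.
Proof. by move=> H K k kn; rewrite H // K. Qed.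

Lemma agree_le n m x y : n <= m -> agree m x y -> agree n x y.
Proof. by move=> nm H k kn; apply: H; lia. Qed.

Lemma agree_eq x y : (forall n, agree n x y) -> x = y.
Proof. by move=> H; apply: functional_extensionality => n; apply: (H (S n)). Qed.

Definition split_at n (x y : cantor) := agree n x y /\ x n <> y n.

Lemma split_exists x y : x <> y -> exists n, split_at n x y.
Proof.
move=> xy; have [|n [Hn mn]] := wf_min lt (fun n => x n <> y n) lt_wf.
  apply: NNPP => H; apply: xy; apply: functional_extensionality => n.
  by apply: NNPP => nn; apply: H; exists n.
by exists n; split=> // k kn; apply: NNPP; apply: mn.
Qed.

Lemma split_neq n x y : split_at n x y -> x <> y.
Proof. by move=> [_ H] E; apply: H; rewrite E. Qed.

Lemma split_unique a b x y : split_at a x y -> split_at b x y -> a = b.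
Proof.
move=> [A1 A2] [B1 B2]; case: (Nat.lt_total a b) => [H|[//|H]].
  by case: A2; apply: B1.
by case: B2; apply: A1.
Qed.

Lemma split_not_agree n m x y : split_at n x y -> agree m x y -> m <= n.
Proof. by move=> [_ H] A; case: (Nat.le_gt_cases m n) => // /A. Qed.

(* The vertices of the binary tree in heap order: the children of [k] are [2k+1], [2k+2]. *)
Fixpoint node (x : cantor) (n : nat) : nat :=
  match n with
  | 0 => 0
  | S m => 2 * node x m + (if x m then 2 else 1)
  end.

Lemma node_agree n x y : agree n x y -> node x n = node y n.
Proof.
elim: n => //= n IH H; have -> := H n (Nat.lt_succ_diag_r n).
by rewrite IH //; apply: agree_le H; lia.
Qed.

Lemma node_inj n m x y : node x n = node y m -> n = m /\ agree n x y.
Proof.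
elim: n m => [|n IH] [|m] /=; first by split=> // k; lia.
- by case: (y m); lia.
- by case: (x n); lia.
move=> H; have [E1 E2] : node x n = node y m /\ x n = y m.
  by move: H; case: (x n); case: (y m) => //; lia.
have [En A] := IH m E1; subst m; split=> // k kn.
have [kn'|->] : k < n \/ k = n by lia.
  exact: A.
exact: E2.
Qed.

Lemma node_ge n x : n <= node x n.
Proof. by elim: n => //= n IH; case: (x n); lia. Qed.

Lemma node_lt n x : S (node x n) < 2 ^ (S n).
Proof.
elim: n => [|n IH]; first by simpl; lia.
by rewrite Nat.pow_succ_r'; cbn [node]; case: (x n); lia.
Qed.

Lemma node_le_pow m n x : m <= n -> node x m <= 2 ^ (S n).
Proof.
move=> mn; have := node_lt m x.
by have := Nat.pow_le_mono_r 2 (S m) (S n); lia.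
Qed.

(** The branches through the set of vertices with characteristic function [c]. Closed sets are thus
    coded by points, and [clt] lists them. *)
Definition decode (c x : cantor) := forall n, c (node x n) = true.

Lemma closed_decode c : closed_set (decode c).
Proof.
move=> x /not_all_ex_not [n Hn]; exists n => y xy /(_ n).
by rewrite -(node_agree n x y).
Qed.

Lemma closed_limit P x : closed_set P -> (forall n, exists y, P y /\ agree n x y) -> P x.
Proof.
move=> cP H; apply: NNPP => /cP [n Hn].
by have [y [Py xy]] := H n; apply: Hn Py.
Qed.

Lemma decode_surjective P : closed_set P -> exists c, forall x, decode c x <-> P x.
Proof.
move=> cP; exists (fun k => if excluded_middle_informative
  (exists y n, P y /\ node y n = k) then true else false) => x; split=> [H|Px n].
  apply: closed_limit => // n; have := H n.
  case: excluded_middle_informative => //= -[y [m [Py E]]] _.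
  by have [-> A] := node_inj _ _ _ _ E; exists y; split=> //; apply: agree_sym.
by case: excluded_middle_informative => // -[]; exists x, n.
Qed.

(** * Skew perfect subsets *)

Definition skew (P : cantor -> Prop) := forall x x' y y' n,
  P x -> P x' -> P y -> P y' -> split_at n x x' -> split_at n y y' -> agree n x y.

Lemma splitting_scheme P : perfect P -> exists (q : nat -> cantor) (d : nat -> nat),
  (forall k, P (q k)) /\ (forall k, q (2 * k + 1) = q k) /\
  (forall k, split_at (d k) (q k) (q (2 * k + 2))) /\
  (forall j k, j < k -> d j < d k).
Proof.
move=> [[x0 Px0] [_ iP]].
have [sp Hsp] : exists sp : cantor * nat -> cantor * nat, forall p, P (fst p) ->
    P (fst (sp p)) /\ snd p <= snd (sp p) /\ split_at (snd (sp p)) (fst p) (fst (sp p)).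
  apply: (choice (fun (p yd : cantor * nat) => P (fst p) ->
    P (fst yd) /\ snd p <= snd yd /\ split_at (snd yd) (fst p) (fst yd))) => -[x n] /=.
  case: (classic (P x)) => [Px|nP]; last by exists (x, n).
  have [y [Py [yx A]]] := iP x Px n.
  have [d Hd] := split_exists x y (fun E => yx (eq_sym E)).
  by exists (y, d) => _; split=> //; split=> //; apply: split_not_agree Hd A.
(* A state is the current table of points together with a lower bound for the next split level;
   stage [k] fills in the two children of [k]. *)
pose step k (s : (nat -> cantor) * nat) :=
  let z := sp (fst s k, snd s) in
  (fun j => if Nat.eqb j (2 * k + 2) then fst z
            else if Nat.eqb j (2 * k + 1) then fst s k else fst s j, S (snd z)).
pose st := nat_rect (fun _ => ((nat -> cantor) * nat)%type) (fun _ => x0, 0) step.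
have stS i : st (S i) = step i (st i) by [].
pose q j := fst (st j) j; pose d k := snd (sp (q k, snd (st k))).
have P_st i j : P (fst (st i) j).
  elim: i j => [|i IH] j //; rewrite stS /step /=.
  by case: Nat.eqb; [apply Hsp; apply: IH | case: Nat.eqb; apply: IH].
have Pq k : P (q k) by exact: P_st.
have st_far i j : i < j -> fst (st j) (2 * i + 1) = q i /\
    fst (st j) (2 * i + 2) = fst (sp (q i, snd (st i))).
  elim: j => [|j IH] ij; first lia.
  rewrite stS /step /=; have [ij'|<-] : i < j \/ i = j by lia.
    rewrite !(proj2 (Nat.eqb_neq _ _)); try lia; exact: IH.
  by rewrite !Nat.eqb_refl (proj2 (Nat.eqb_neq _ _)) //; lia.
have Hd k : snd (st k) <= d k /\ split_at (d k) (q k) (q (2 * k + 2)).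
  have [_ H] := Hsp (q k, snd (st k)) (Pq k).
  by rewrite {2}/q (proj2 (st_far k (2 * k + 2) _)) //; lia.
exists q, d; split=> //; split; last split.
- by move=> k; rewrite {1}/q (proj1 (st_far k _ _)) //; lia.
- by move=> k; case: (Hd k).
- have dS k : d k < d (S k) by case: (Hd (S k)); rewrite stS /step /= -/(q k) -/(d k); lia.
  move=> j; elim=> [|k IH] jk; first lia.
  have [jk'|->] : j < k \/ j = k by lia.
    by have := dS k; have := IH jk'; lia.
  exact: dS.
Qed.

Definition image (f : cantor -> cantor) (K : cantor -> Prop) (y : cantor) :=
  exists x, K x /\ y = f x.

(** The second clause is a uniform modulus for the inverse; it lets closedness of images be proved
    without compactness. *)
Definition embedding (f : cantor -> cantor) :=
  (forall n x y, agree n x y -> agree n (f x) (f y)) /\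
  (forall n, exists m, forall x y, agree m (f x) (f y) -> agree n x y).

Lemma embedding_inj f x y : embedding f -> f x = f y -> x = y.
Proof.
move=> [_ H] E; apply: agree_eq => n; have [m Hm] := H n.
by apply: Hm; rewrite E.
Qed.

(** Branches parting at vertex [k] have images parting at level [d k]. As [d] is injective on
    vertices, no level carries two splitting nodes. *)
Lemma perfect_embedding P : perfect P -> exists f,
  embedding f /\ (forall x, P (f x)) /\ skew (image f univ).
Proof.
move=> pP; have [q [d [Pq [q1 [q2 dlt]]]]] := splitting_scheme P pP.
have [_ [cP _]] := pP.
have d_ge k : k <= d k.
  by elim: k => [|k IH]; [lia | have := dlt k (S k); lia].
have d_le j k : j <= k -> d j <= d k.
  move=> jk; have [H|->] : j < k \/ j = k by lia.
    by have := dlt _ _ H; lia.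
  lia.
have d_inj j k : d j = d k -> j = k.
  by move=> E; case: (Nat.lt_total j k) => [/dlt|[|/dlt]] //; lia.
have node_S x n : node x n < node x (S n) by rewrite /=; case: (x n); lia.
have qS x n : agree (d (node x n)) (q (node x (S n))) (q (node x n)).
  rewrite /=; case: (x n); last by rewrite q1.
  by apply: agree_sym; case: (q2 (node x n)).
have qle x n m : n <= m -> agree (d (node x n)) (q (node x m)) (q (node x n)).
  elim: m => [|m IH] nm; first by (have -> : n = 0 by lia).
  have [H|->] : n <= m \/ n = S m by lia.
    apply: agree_trans (IH H); apply: agree_le (qS x m); apply: d_le.
    elim: H => // k _ H; have := node_S x k; lia.
  by [].
(* The limit of [q] along the branch [x]: coordinate [m] is settled at depth [m + 1], because
   [d (node x (S m))] exceeds [m]. *)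
pose f x : cantor := fun m => q (node x (S m)) m.
have fq x n : agree (d (node x n)) (f x) (q (node x n)).
  move=> k kd; rewrite /f; have [H|H] : n <= S k \/ S k <= n by lia.
    exact: qle.
  symmetry; apply: qle => //; have := node_ge (S k) x; have := d_ge (node x (S k)); lia.
have split_f x y n : split_at n x y -> split_at (d (node x n)) (f x) (f y).
  move=> [A D]; have E := node_agree _ _ _ A; split.
    by apply: agree_trans (fq x n) _; rewrite E; apply: agree_sym.
  have ltx := dlt _ _ (node_S x n); have lty := dlt _ _ (node_S y n).
  rewrite (fq x (S n)) // (fq y (S n)); last by rewrite E.
  have [_ D'] := q2 (node x n).
  by rewrite /= -E; move: D; case: (x n); case: (y n) => // _; rewrite q1 // => D;
    apply: D'; rewrite D.
have ef : embedding f.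
  split=> [n x y A|n].
    apply: (agree_le _ (d (node x n))).
      by have := node_ge n x; have := d_ge (node x n); lia.
    apply: agree_trans (fq x n) _; rewrite (node_agree _ _ _ A).
    by apply: agree_sym; apply: fq.
  (* [2 ^ (S n)] bounds all vertices of depth at most [n], so a split of [x] and [y] below [n] would
     show in the images before this level. *)
  exists (S (d (2 ^ (S n)))) => x y A.
  case: (classic (x = y)) => [->//|/split_exists [m Hm]].
  have := split_not_agree _ _ _ _ (split_f _ _ _ Hm) A.
  case: Hm => Am _ H; apply: agree_le Am.
  case: (Nat.le_gt_cases n m) => // mn.
  by have := d_le _ _ (node_le_pow m n x _); lia.
exists f; split=> //; split.
  move=> x; apply: closed_limit => // n; exists (q (node x n)); split=> //.
  apply: agree_le (fq x n); have := node_ge n x; have := d_ge (node x n); lia.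
move=> _ _ _ _ n [x [_ ->]] [x' [_ ->]] [y [_ ->]] [y' [_ ->]] Sx Sy.
have [i Hi] := split_exists x x' (fun E => split_neq _ _ _ Sx (f_equal f E)).
have [j Hj] := split_exists y y' (fun E => split_neq _ _ _ Sy (f_equal f E)).
have Ei := split_unique _ _ _ _ (split_f _ _ _ Hi) Sx.
have Ej := split_unique _ _ _ _ (split_f _ _ _ Hj) Sy.
have E : node x i = node y j by apply: d_inj; rewrite Ei Ej.
rewrite -{1}Ei; apply: agree_trans (fq x i) _; rewrite E.
exact: agree_sym.
Qed.

(** For closedness, the preimages [s n] of approximations to [y] converge by the modulus of the
    inverse; their limit is read off diagonally. *)
Lemma image_perfect f K : embedding f -> perfect K -> perfect (image f K).
Proof.
move=> ef [[x0 K0] [cK iK]]; have [cf uf] := ef; split; last split.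
- by exists (f x0), x0.
- move=> y ny; apply: NNPP => H; apply: ny.
  have H' n : exists x, K x /\ agree n y (f x).
    apply: NNPP => H1; apply: H; exists n => z yz [x [Kx E]].
    by apply: H1; exists x; rewrite -E.
  have [m Hm] := choice _ uf.
  have [s Hs] : exists s : nat -> cantor, forall n, K (s n) /\ agree n y (f (s n)) /\
      forall i, i <= n -> agree (m i) y (f (s n)).
    apply: (choice (fun n z => K z /\ agree n y (f z) /\
      forall i, i <= n -> agree (m i) y (f z))) => n.
    have [M HM] : exists M, forall i, i <= n -> m i <= M.
      elim: n => [|n [M IH]]; first by exists (m 0) => i /Nat.le_0_r ->.
      exists (M + m (S n)) => i Hi; have [H1|->] : i <= n \/ i = S n by lia.
        by have := IH i H1; lia.
      lia.
    have [x [Kx A]] := H' (M + n); exists x; split=> //; split=> [|i Hi].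
      by apply: agree_le A; lia.
    by apply: agree_le A; have := HM i Hi; lia.
  pose x : cantor := fun k => s (S k) k.
  have xs n : agree n x (s n).
    move=> k kn; rewrite /x.
    suff A : agree (S k) (s (S k)) (s n) by apply: A; lia.
    apply: Hm; apply: (agree_trans _ _ y); [apply: agree_sym|]; apply Hs; lia.
  have Kx : K x by apply: closed_limit => // n; exists (s n); split=> //; apply Hs.
  exists x; split=> //; apply: agree_eq => n.
  apply: agree_trans (agree_sym _ _ _ (cf _ _ _ (xs n))); apply Hs.
- move=> _ [x [Kx ->]] n; have [y [Ky [yx A]]] := iK x Kx n.
  exists (f y); split; first by exists y.
  by split; [move=> /(embedding_inj _ _ _ ef) | apply: cf].
Qed.

(** * Codes of closed sets and condensation points *)

Lemma closed_code P : closed_set P -> exists c, decode c = P.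
Proof.
move=> /decode_surjective [c Hc]; exists c; apply: functional_extensionality => x.
exact: propositional_extensionality.
Qed.

(** Basic neighbourhoods are indexed by vertices, hence countable in number; [g k] enumerates the
    trace of [F] on neighbourhood [k] whenever this is countable. *)
Lemma locally_countable (F G : cantor -> Prop) :
  (forall y, G y -> F y) ->
  (forall y, G y -> exists n, countable (fun z => F z /\ agree n y z)) -> countable G.
Proof.
move=> GF H; pose U k z := F z /\ exists n, node z n = k.
have [g Hg] : exists g : nat -> nat -> cantor, forall k, countable (U k) ->
    forall z, U k z -> exists m, g k m = z.
  apply: (choice (fun k h => countable (U k) -> forall z, U k z -> exists m, h m = z)) => k.
  case: (classic (countable (U k))) => [[h Hh]|nc]; last by exists (fun _ _ => true).
  by exists h => _ z /Hh [m [_ E]]; exists m.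
apply: covers_trans covers_nat_nat _; apply: (covers_image _ _ (fun p => g (fst p) (snd p))).
move=> y Gy; have [n cn] := H y Gy.
have cU : countable (U (node y n)).
  apply: covers_trans cn (covers_sub _ _ _) => z [Fz [m E]].
  by have [-> A] := node_inj _ _ _ _ E; split=> //; apply: agree_sym.
have [|m E] := Hg (node y n) cU y; first by split; [apply: GF | exists n].
by exists (node y n, m).
Qed.

(* Cantor-Bendixson: the condensation points of an uncountable closed set are perfect. *)
Lemma uncountable_closed_perfect F : closed_set F -> ~ countable F ->
  exists K, perfect K /\ forall x, K x -> F x.
Proof.
move=> cF nF; pose K x := F x /\ forall n, ~ countable (fun z => F z /\ agree n x z).
have nK x : F x -> ~ K x -> exists n, countable (fun z => F z /\ agree n x z).
  move=> Fx nKx; apply: NNPP => H; apply: nKx; split=> // n cn; apply: H; by exists n.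
exists K; split; last by move=> x [].
split; last split.
- apply: NNPP => H; apply: nF; apply: (locally_countable F) => // y Fy.
  by apply: nK => // Ky; apply: H; exists y.
- move=> x nKx; case: (classic (F x)) => [Fx|/cF [n Hn]]; last first.
    by exists n => y xy [Fy _]; apply: Hn Fy.
  have [n cn] := nK x Fx nKx; exists n => y xy [_ /(_ n)]; apply.
  apply: covers_trans cn (covers_sub _ _ _) => z [Fz yz]; split=> //.
  exact: agree_trans yz.
- move=> x [Fx ncx] n; apply: NNPP => H; apply: (ncx n).
  pose G z := (F z /\ agree n x z) /\ z <> x.
  have [g Hg] : countable G.
    apply: (locally_countable F) => [z [[]] //|z [[Fz xz] zx]].
    by apply: nK => // Kz; apply: H; exists z.
  exists (fun k => match k with 0 => x | S m => g m end) => z [Fz xz].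
  case: (classic (z = x)) => [->|zx]; first by exists 0.
  have [m [_ E]] := Hg z (conj (conj Fz xz) zx); by exists (S m).
Qed.

(** * Translations *)

Lemma cadd_comm x y : cadd x y = cadd y x.
Proof. by apply: functional_extensionality => n; apply: xorb_comm. Qed.

Lemma cadd_assoc x y z : cadd x (cadd y z) = cadd (cadd x y) z.
Proof. by apply: functional_extensionality => n; rewrite /cadd xorb_assoc. Qed.

Lemma caddK x t : cadd (cadd x t) t = x.
Proof.
by apply: functional_extensionality => n; rewrite /cadd xorb_assoc xorb_nilpotent xorb_false_r.
Qed.

Lemma agree_cadd n x y t : agree n x y -> agree n (cadd x t) (cadd y t).
Proof. by move=> H k /H; rewrite /cadd => ->. Qed.

Lemma split_cadd n x y t : split_at n x y -> split_at n (cadd x t) (cadd y t).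
Proof.
move=> [A D]; split; first exact: agree_cadd.
by rewrite /cadd => E; apply: D; move: E; case: (x n); case: (y n); case: (t n).
Qed.

Definition shift (P : cantor -> Prop) (t x : cantor) := P (cadd x t).

Lemma closed_shift P t : closed_set P -> closed_set (shift P t).
Proof.
by move=> cP x /cP [n Hn]; exists n => y xy; apply: Hn; apply: agree_cadd.
Qed.

Lemma perfect_shift P t : perfect P -> perfect (shift P t).
Proof.
move=> [[x Px] [cP iP]]; split; last split.
- by exists (cadd x t); rewrite /shift caddK.
- exact: closed_shift.
- move=> y Py n; have [z [Pz [zy A]]] := iP _ Py n.
  exists (cadd z t); split; [|split]; first by rewrite /shift caddK.
    by move=> E; apply: zy; rewrite -E caddK.
  by rewrite -(caddK y t); apply: agree_cadd.
Qed.

(** * Columns and Marczewski null sets *)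

Lemma perfect_column a : perfect (fun x => evens x = a).
Proof.
split; last split.
- by exists (interleave a a); rewrite evens_interleave.
- move=> x nx; have [n [_ Hn]] := split_exists _ _ nx.
  exists (S (2 * n)) => y xy E; apply: Hn; rewrite -E /evens; apply: xy; lia.
- move=> x <- n; exists (fun k => if Nat.eqb k (S (2 * n)) then negb (x k) else x k).
  split; [|split].
  + apply: functional_extensionality => k; rewrite /evens.
    by rewrite (proj2 (Nat.eqb_neq _ _)) //; lia.
  + move=> E; have := f_equal (fun g => g (S (2 * n))) E.
    by rewrite /= Nat.eqb_refl; case: (x _).
  + by move=> k kn; rewrite (proj2 (Nat.eqb_neq _ _)) //; lia.
Qed.

(** [P] contains disjoint perfect sets [V a], one for each point [a]. If [S] met them all, sending a
    point of [V a] to [a] would map [S] onto the Cantor space. *)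
Lemma perfect_avoiding_small P S : perfect P -> small S ->
  exists Q, perfect Q /\ (forall x, Q x -> P x) /\ forall x, Q x -> ~ S x.
Proof.
move=> pP sS; have [f [ef [Pf _]]] := perfect_embedding P pP.
pose V a := image f (fun x => evens x = a).
apply: NNPP => H; apply: sS; apply: (covers_functional _ _ (fun s a => V a s)).
- exact: (inhabits (fun _ => true)).
- move=> a _; apply: NNPP => H'; apply: H; exists (V a); split; [|split].
  + exact: image_perfect (perfect_column a).
  + by move=> _ [x [_ ->]].
  + by move=> x Vx Sx; apply: H'; exists x.
- by move=> s a b _ _ _ [x [<- ->]] [y [<- /(embedding_inj _ _ _ ef) ->]].
Qed.

Lemma small_s0 S : small S -> s0 S.
Proof. by move=> sS P pP; apply: perfect_avoiding_small. Qed.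

(* If [A] is not itself Marczewski null, it meets every perfect subset of some perfect set
   [P], which splits into continuum many perfect columns [V a].  One chooses [x a] in [V a]
   outside each earlier perfect set having countable trace on [V a]. *)
Lemma s0_subset_of_size_continuum A : ~ small A ->
  exists B, (forall x, B x -> A x) /\ ~ small B /\ s0 B.
Proof.
move=> bA; case: (classic (s0 A)) => [sA|nA]; first by exists A.
have [P [pP HP]] : exists P, perfect P /\
    forall Q, perfect Q -> (forall x, Q x -> P x) -> exists x, Q x /\ A x.
  apply: NNPP => H; apply: nA => P pP; apply: NNPP => H'; apply: H.
  exists P; split=> // Q pQ QP; apply: NNPP => H2; apply: H'; exists Q; split=> //; split=> //.
  by move=> x Qx Ax; apply: H2; exists x.
have [f [ef [Pf _]]] := perfect_embedding P pP.
pose V a := image f (fun x => evens x = a).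
have pV a : perfect (V a) by exact: image_perfect (perfect_column a).
have VP a x : V a x -> P x by move=> [y [_ ->]].
have V_inj a b x : V a x -> V b x -> a = b.
  by move=> [y [<- ->]] [z [<- /(embedding_inj _ _ _ ef) ->]].
have bVA a : ~ small (fun x => V a x /\ A x).
  move=> sVA; have [Q [pQ [QV QA]]] := perfect_avoiding_small _ _ (pV a) sVA.
  have [|x [Qx Ax]] := HP Q pQ; first by move=> x /QV /VP.
  by apply: (QA x Qx); split=> //; apply: QV.
have [x Hx] : exists x : cantor -> cantor, forall a, (V a (x a) /\ A (x a)) /\
    forall b, clt b a -> countable (fun y => decode b y /\ V a y) -> ~ decode b (x a).
  apply: (choice (fun a y => (V a y /\ A y) /\
    forall b, clt b a -> countable (fun y => decode b y /\ V a y) -> ~ decode b y)) => a.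
  (* Otherwise the earlier countable traces cover the part of [A] in [V a], which is too large for
     [below a] times [nat]. *)
  apply: NNPP => H; apply: (bVA a).
  have [g Hg] : exists g : cantor -> nat -> cantor, forall b,
      countable (fun y => decode b y /\ V a y) ->
      forall y, decode b y /\ V a y -> exists n, g b n = y.
    apply: (choice (fun b h => countable (fun y => decode b y /\ V a y) ->
      forall y, decode b y /\ V a y -> exists n, h n = y)) => b.
    case: (classic (countable (fun y => decode b y /\ V a y))) => [[h Hh]|nc].
      by exists h => _ y /Hh [m [_ E]]; exists m.
    by exists (fun _ _ => true).
  apply: small_covers (small_setX_nat _ (small_below a)).
  exists (fun p => g (fst p) (snd p)) => y [Vy Ay].
  apply: NNPP => H'; apply: H; exists y; split=> // b ba cb dy.
  have [n E] := Hg b cb y (conj dy Vy).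
  by apply: H'; exists (b, n).
exists (fun y => exists a, y = x a); split; last split.
- by move=> _ [a ->]; case: (Hx a) => -[].
- apply; apply: (covers_functional _ _ (fun s a => V a s)).
  + exact: (inhabits (fun _ => true)).
  + by move=> a _; exists (x a); split; [exists a | case: (Hx a) => -[]].
  + by move=> s a b _ _ _; apply: V_inj.
- move=> Q pQ; have [_ [cQ _]] := pQ; have [b Eb] := closed_code Q cQ.
  (* An uncountable trace on [V a] contains a perfect set, where only [x a] has to be avoided. If
     all traces are countable, [x a] escapes [Q] for every [a] above the code [b]. *)
  case: (classic (exists a, ~ countable (fun y => Q y /\ V a y))) => [[a na]|H].
    have [|K [pK HK]] := uncountable_closed_perfect _ _ na.
      have [_ [cV _]] := pV a.
      by move=> y /not_and_or [/cQ|/cV] [n Hn]; exists n => z /Hn nz [Qz Vz]; apply: nz.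
    have [L [pL [LK Lx]]] := perfect_avoiding_small _ _ pK (small_point (x a)).
    exists L; split=> //; split=> [z /LK /HK [] //|z Lz [a' E]].
    have [Qz Vz] := HK z (LK z Lz).
    apply: (Lx z Lz); rewrite E; f_equal; apply: (V_inj _ _ z) => //.
    by rewrite E; case: (Hx a') => -[].
  have sQ : small (fun y => Q y /\ exists a, y = x a).
    apply: small_covers (small_not_above b).
    apply: (covers_image _ _ x) => y [Qy [a E]]; exists a; split=> // ba.
    have [_ /(_ b ba)] := Hx a; rewrite Eb -E; apply=> //.
    by apply: NNPP => nc; apply: H; exists a.
  have [L [pL [LQ Ls]]] := perfect_avoiding_small _ _ pQ sQ.
  exists L; split=> //; split=> // z Lz zB; apply: (Ls z Lz); split=> //; exact: LQ.
Qed.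

(** * Families almost disjoint up to translation *)

Definition overlap (P Q : cantor -> Prop) :=
  exists K, perfect K /\ forall x, K x -> P x /\ Q x.

Lemma countable_inter P Q : closed_set P -> closed_set Q -> ~ overlap P Q ->
  countable (fun x => P x /\ Q x).
Proof.
move=> cP cQ no; apply: NNPP => nc; apply: no.
apply: uncountable_closed_perfect nc.
by move=> y /not_and_or [/cP|/cQ] [n Hn]; exists n => z /Hn nz [Qz Vz]; apply: nz.
Qed.

Lemma overlap_shift P Q t : overlap P (shift Q t) -> overlap Q (shift P t).
Proof.
move=> [K [pK HK]]; exists (shift K t); split; first exact: perfect_shift.
by move=> x /HK [H1 H2]; split=> //; rewrite -(caddK x t).
Qed.

(** Codes are accepted greedily along [clt]. A skew perfect subset of [P] is either accepted or
    overlaps a translate of an accepted set, which gives the last clause. *)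
Lemma skew_family_exists : exists M : cantor -> Prop,
  (forall b, M b -> skew (decode b)) /\
  (forall b b' t, M b -> M b' -> b <> b' -> ~ overlap (decode b) (shift (decode b') t)) /\
  (forall P, perfect P -> exists b t Q, M b /\ perfect Q /\
    (forall x, Q x -> P x) /\ forall x, Q x -> shift (decode b) t x).
Proof.
have [M HM] := @wf_recursion cantor Prop clt (fun b f => (perfect (decode b) /\ skew (decode b)) /\
  forall b' (h : clt b' b), f b' h -> forall t, ~ overlap (decode b) (shift (decode b') t)) clt_wf.
exists M; split; last split.
- by move=> b; rewrite HM => -[[_ H] _].
- move=> b b' t Mb Mb' nb; have [H|[//|H]] := clt_total b b'.
    by move=> /overlap_shift; move: Mb'; rewrite HM => -[_ /(_ b H Mb t)].
  by move: Mb; rewrite HM => -[_ /(_ b' H Mb' t)].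
- move=> P pP; have [f [ef [Pf sf]]] := perfect_embedding P pP.
  (* [z] is both the index of a column, making [Q] perfect, and the zero translation. *)
  pose z : cantor := fun _ => false.
  pose Q := image f (fun x => evens x = z).
  have pQ : perfect Q by exact: image_perfect (perfect_column z).
  have QP x : Q x -> P x by move=> [y [_ ->]].
  have [_ [cQ _]] := pQ; have [c Ec] := closed_code Q cQ.
  case: (classic (M c)) => [Mc|nM].
    exists c, z, Q; split=> //; split=> //; split=> // x Qx.
    rewrite Ec /shift; suff -> : cadd x z = x by [].
    by apply: functional_extensionality => n; rewrite /cadd xorb_false_r.
  apply: NNPP => H; apply: nM; rewrite HM Ec; split.
    split=> // x x' y y' n [u [_ ->]] [u' [_ ->]] [v [_ ->]] [v' [_ ->]].
    by apply: sf; eexists; split; eauto; done.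
  move=> b' _ Mb' t [K [pK HK]]; apply: H.
  exists b', t, K; split=> //; split=> //; split=> x /HK [] //.
  by move=> /QP.
Qed.

(** Two common points splitting at [m], beyond a level [n] where [t] and [t'] differ, give two pairs
    in [P] splitting at [m]. Skewness makes [x + t] and [x + t'] agree below [m], hence at [n]. *)
Lemma skew_shift_overlap P t t' : skew P -> t <> t' -> ~ overlap (shift P t) (shift P t').
Proof.
move=> sP /split_exists [n [_ Dn]] [K [[[x Kx] [_ iK]] HK]].
have [y [Ky [yx A]]] := iK x Kx (S n).
have [m Hm] := split_exists x y (fun E => yx (eq_sym E)).
have nm := split_not_agree _ _ _ _ Hm A.
have [Px Px'] := HK x Kx; have [Py Py'] := HK y Ky.
have Am := sP _ _ _ _ m Px Py Px' Py' (split_cadd _ _ _ t Hm) (split_cadd _ _ _ t' Hm).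
have := Am n nm; rewrite /cadd => E.
by apply: Dn; move: E; case: (x n); case: (t n); case: (t' n).
Qed.

(** A member of [D] with code [b] contains [a + x a] only for [a] not above [b], hence meets the set
    of these points in a small set. *)
Lemma s0_translation_cover (X : cantor -> Prop) (D : (cantor -> Prop) -> Prop) :
  (forall P, perfect P -> exists Q, perfect Q /\ (forall x, Q x -> P x) /\ D Q) ->
  (forall a, exists x, X x /\ forall b, clt b a -> D (decode b) -> ~ decode b (cadd a x)) ->
  exists Y, s0 Y /\ forall z, sumset X Y z.
Proof.
move=> dense /choice [x Hx].
exists (fun y => exists a, y = cadd a (x a)); split; last first.
  move=> a; exists (x a), (cadd a (x a)); split; first by case: (Hx a).
  by split; [exists a | rewrite cadd_comm caddK].
move=> P /dense [Q [pQ [QP DQ]]]; have [_ [cQ _]] := pQ; have [b Eb] := closed_code Q cQ.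
have sQ : small (fun y => Q y /\ exists a, y = cadd a (x a)).
  apply: small_covers (small_not_above b).
  apply: (covers_image _ _ (fun a => cadd a (x a))) => y [Qy [a E]].
  exists a; split=> // ba; have [_ /(_ b ba)] := Hx a.
  by rewrite Eb -E; apply.
have [L [pL [LQ Ls]]] := perfect_avoiding_small _ _ pQ sQ.
exists L; split=> //; split=> [z /LQ /QP //|z Lz zY].
by apply: (Ls z Lz); split=> //; apply: LQ.
Qed.

(** * The covering set *)

(** Both segments lie in that of the larger point, whose square is bounded by [below_square]. *)
Lemma small_below_setX a b : small (setX (below a) (below b)).
Proof.
have [m [am bm]] : exists m, (forall x, below a x -> below m x) /\
                             (forall x, below b x -> below m x).
  have [H|[->|H]] := clt_total a b; [exists b | by exists b | exists a];
    by split=> // x xy; apply: clt_trans H.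
apply: small_covers (small_setX_nat _ (small_below m)).
apply: covers_trans (below_square m) _.
by apply: covers_setX; apply: covers_sub.
Qed.

Lemma countable_below_union a b (U : cantor -> cantor -> cantor -> Prop) (T : cantor -> Prop) :
  (forall x, T x -> exists i j, below a i /\ below b j /\ countable (U i j) /\ U i j x) ->
  small T.
Proof.
move=> H.
have [g Hg] : exists g : cantor * cantor -> nat -> cantor, forall p,
    countable (U (fst p) (snd p)) -> forall y, U (fst p) (snd p) y -> exists n, g p n = y.
  apply: (choice (fun p h => countable (U (fst p) (snd p)) ->
    forall y, U (fst p) (snd p) y -> exists n, h n = y)) => p.
  case: (classic (countable (U (fst p) (snd p)))) => [[h Hh]|nc].
    by exists h => _ y /Hh [m [_ E]]; exists m.
  by exists (fun _ _ => true).
apply: small_covers (small_setX_nat _ (small_below_setX a b)).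
exists (fun p => g (fst p) (snd p)) => x /H [i [j [ia [jb [cU Ux]]]]].
by have [n E] := Hg (i, j) cU x Ux; exists ((i, j), n).
Qed.

Lemma s0_sub Y Z : s0 Y -> (forall x, Z x -> Y x) -> s0 Z.
Proof.
by move=> sY ZY P /sY [Q [pQ [QP QY]]]; exists Q; split=> //; split=> // z /QY nY /ZY.
Qed.

Lemma continuum_translation_cover (X : cantor -> Prop) :
  ~ small X -> exists Y, s0 Y /\ forall z, sumset X Y z.
Proof.
move=> bX; have [M [skM [orthM denseM]]] := skew_family_exists.
pose D0 (Q : cantor -> Prop) := exists ct : cantor * cantor, M (fst ct) /\
  forall x, Q x -> decode (fst ct) (cadd x (snd ct)).
case: (classic (forall a, exists x, X x /\
    forall b, clt b a -> D0 (decode b) -> ~ decode b (cadd a x))) => [H|].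
  apply: s0_translation_cover H => P /denseM [b [t [Q [Mb [pQ [QP Qb]]]]]].
  by exists Q; split=> //; split=> //; exists (b, t).
move=> /not_all_ex_not [a0 Ha0].
have [ct Hct] : exists ct : cantor -> cantor * cantor, forall i, D0 (decode i) ->
    M (fst (ct i)) /\ forall x, decode i x -> decode (fst (ct i)) (cadd x (snd (ct i))).
  apply: (choice (fun i ct => D0 (decode i) ->
    M (fst ct) /\ forall x, decode i x -> decode (fst ct) (cadd x (snd ct)))) => i.
  by case: (classic (D0 (decode i))) => [[p Hp]|]; [exists p | exists (a0, a0)].
(* Adding [a0] to the translation turns membership of [a0 + x] in the set coded by [i] into
   membership of [x] in a translate of the set coded by [c i]. *)
pose c i := fst (ct i); pose w i := cadd a0 (snd (ct i)).
have [i Hi] : exists i : cantor -> cantor, forall x, X x ->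
    clt (i x) a0 /\ M (c (i x)) /\ decode (c (i x)) (cadd x (w (i x))).
  apply: (choice (fun x i => X x -> clt i a0 /\ M (c i) /\ decode (c i) (cadd x (w i)))) => x.
  apply: NNPP => H; apply: Ha0; exists x; split.
    by apply: NNPP => nX; apply: H; exists x.
  move=> b ba Db db; apply: H; exists b => _; have [Mb Hb] := Hct b Db.
  by split=> //; split=> //; rewrite /w cadd_assoc (cadd_comm x); apply: Hb.
pose k x := c (i x); pose rho x := cadd x (w (i x)).
pose A Z b r := exists x, Z x /\ k x = b /\ r = rho x.
have [Z [ZX [bZ sZ]]] : exists Z : cantor -> Prop,
    (forall x, Z x -> X x) /\ ~ small Z /\ forall b, s0 (A Z b).
  case: (classic (exists b, ~ small (A X b))) => [[b bA]|H]; last first.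
    exists X; split=> //; split=> // b; apply: small_s0; apply: NNPP => nb.
    by apply: H; exists b.
  have [B [BA [bB sB]]] := s0_subset_of_size_continuum _ bA.
  (* [rho] maps this set onto [B], so it is not small; all its images, for whatever index, lie in
     [B]. *)
  exists (fun x => X x /\ B (rho x)); split; [|split].
  - by move=> x [].
  - move=> sZ; apply: bB; apply: small_covers sZ; apply: (covers_image _ _ rho) => r Br.
    by have [x [Xx [_ E]]] := BA r Br; exists x; rewrite -E.
  - by move=> b'; apply: s0_sub sB _ => _ [x [[_ Bx] [_ ->]]].
pose D (Q : cantor -> Prop) := exists ct : cantor * cantor, M (fst ct) /\
  forall x, Q x -> decode (fst ct) (cadd x (snd ct)) /\ ~ A Z (fst ct) (cadd x (snd ct)).
suff [Y [sY HY]] : exists Y, s0 Y /\ forall z, sumset Z Y z.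
  exists Y; split=> // z; have [x [y [Zx [Yy E]]]] := HY z.
  by exists x, y; split; [apply: ZX|].
apply: (s0_translation_cover _ D).
  move=> P /denseM [b [t [Q [Mb [pQ [QP Qb]]]]]].
  have [K [pK [KQ KA]]] := sZ b (shift Q t) (perfect_shift _ _ pQ).
  have KQ' x : shift K t x -> Q x by move=> /KQ; rewrite /shift caddK.
  exists (shift K t); split; [exact: perfect_shift | split; first by move=> x /KQ' /QP].
  by exists (b, t); split=> // x Kx; split; [apply: Qb; apply: KQ' | apply: KA].
move=> a.
have [du Hdu] : exists du : cantor -> cantor * cantor, forall b, D (decode b) ->
    M (fst (du b)) /\ forall x, decode b x ->
      decode (fst (du b)) (cadd x (snd (du b))) /\ ~ A Z (fst (du b)) (cadd x (snd (du b))).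
  apply: (choice (fun b ct => D (decode b) -> M (fst ct) /\ forall x, decode b x ->
    decode (fst ct) (cadd x (snd ct)) /\ ~ A Z (fst ct) (cadd x (snd ct)))) => b.
  by case: (classic (D (decode b))) => [[p Hp]|]; [exists p | exists (a0, a0)].
apply: NNPP => H; apply: bZ.
pose v b := cadd a (snd (du b)).
(* If the choice fails at [a], each [x] in [Z] lies in a translate by [v b] with [b] below [a] and
   in one by [w j] with [j] below [a0]. *)
apply: (countable_below_union a a0 (fun b j x =>
  shift (decode (fst (du b))) (v b) x /\ shift (decode (c j)) (w j) x)) => x Zx.
have [ia [Mi di]] := Hi x (ZX x Zx).
have [b [ba [Db db]]] : exists b, clt b a /\ D (decode b) /\ decode b (cadd a x).
  apply: NNPP => nb; apply: H; exists x; split=> // b ba Db db.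
  by apply: nb; exists b.
have [Mb Hb] := Hdu b Db.
have Ev : cadd x (v b) = cadd (cadd a x) (snd (du b)) by rewrite /v cadd_assoc (cadd_comm x).
have [db' nA] := Hb _ db.
exists b, (i x); split=> //; split=> //; split; last first.
  by split=> //; rewrite /shift Ev.
apply: countable_inter; try by apply: closed_shift; apply: closed_decode.
(* For equal members the translations differ, since otherwise [x] would witness membership in the
   image that [nA] excludes. Different members are handled by [orthM]. *)
case: (classic (fst (du b) = c (i x))) => [Ec|nc].
  rewrite Ec; apply: skew_shift_overlap; first exact: skM.
  move=> Et; apply: nA; exists x; split=> //; split; first by rewrite /k Ec.
  by rewrite /rho -Et Ev.
move=> [K [pK HK]].
apply: (orthM _ _ (cadd (v b) (w (i x))) Mb Mi nc).
exists (shift K (v b)); split; first exact: perfect_shift.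
move=> y /HK []; rewrite /shift caddK => H1 H2; split=> //.
by rewrite cadd_assoc.
Qed.

Theorem theorem1p1 (X : cantor -> Prop) :
  card_continuum X ->
  ~ shiftable s0 X /\ (exists Y, s0 Y /\ forall z, sumset X Y z).
Proof.
move=> [f [_ Hf]].
have bX : ~ small X.
  apply; apply: (covers_functional _ _ (fun x z => exists Xx, f (exist _ x Xx) = z)).
  - exact: (inhabits (fun _ => true)).
  - by move=> z _; have [[x Xx] E] := Hf z; exists x; split=> //; exists Xx.
  - by move=> x z z' _ _ _ [p <-] [q <-]; rewrite (proof_irrelevance _ p q).
have [Y [sY HY]] := continuum_translation_cover X bX.
split; last by exists Y.
by move=> sX; have [z] := sX Y sY; apply.
Qed.
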